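(* For any integer $n>0$ there exists a constant $C(n)$ (depending only on $n$) with the following property. Suppose a group $G$ generated by elements $g_1,\ldots,g_n$ acts by isometries on a $\delta$-hyperbolic geodesic metric space $(X,d)$, where $\delta>0$. Put $M=(g_1,\ldots,g_n)$. Then one of the following holds: (1) The group $G$ is free on $M=(g_1,\ldots,g_n)$, and for any $x\in X$ the map $G\to X$ defined by $h\mapsto hx$ is a quasi-isometric embedding (where $G$ is considered with the free group word metric with respect to $M$). (2) The tuple $M$ is Nielsen-equivalent to a tuple $M'=(f_1,\ldots,f_n)$ such that $d(f_1y,y)<\delta\, C(n)$ for some $y\in X$.
   Context: A geodesic metric space $(X,d)$ is $\delta$-hyperbolic if for any $x,y,z\in X$ and any geodesic segments $[x,y]$, $[x,z]$, $[y,z]$ the segment $[x,y]$ is contained in the $\delta$-neighborhood of $[x,z]\cup[y,z]$. Nielsen equivalence: for an $n$-tuple $M=(g_1,\ldots,g_n)\in G^n$ the elementary Nielsen moves are: (N1) for some $i$ replace $g_i$ by $g_i^{-1}$; (N2) for some $i\neq j$ replace $g_i$ by $g_ig_j$; (N3) for some $i\neq j$ interchange $g_i$ and $g_j$. Two $n$-tuples are Nielsen-equivalent if one can be transformed into the other by a finite chain of elementary Nielsen moves. ''$G$ is free on $M$'' means that $G$ is a free group with free basis $g_1,\ldots,g_n$ (of rank $n$). *)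

(* Defs.v *)
From mathcomp Require Import all_boot all_order all_algebra all_fingroup.
From mathcomp Require Import all_classical all_reals.
From mathcomp Require Import topology.
From Stdlib Require Import Relation_Operators.

Set Implicit Arguments.
Unset Strict Implicit.
Unset Printing Implicit Defensive.

Import Order.TTheory GRing.Theory Num.Theory.

Local Open Scope classical_set_scope.
Local Open Scope ring_scope.

Section Hyperbolic.
Context {R : realType} {X : metricType R}.
Implicit Types (x y z : X) (A B C : set X) (d : R).

Definition geodesic_segment x y A : Prop :=
  exists gamma : R -> X,
    [/\ gamma 0 = x, gamma (mdist x y) = y,
        {in `[0, mdist x y] &, forall s t,
          mdist (gamma s) (gamma t) = `|s - t|}
      & A = gamma @` [set` `[0, mdist x y]]].

(* Closed neighborhood. The sets A used below are unions of two geodesic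
   segments, hence compact, so this is {p | dist(p, A) <= d}. *)
Definition neighborhood d A : set X :=
  [set p | exists2 q, A q & mdist p q <= d].

Definition hyperbolic d : Prop :=
  forall x y z A B C,
    geodesic_segment x y A -> geodesic_segment x z B ->
    geodesic_segment y z C -> A `<=` neighborhood d (B `|` C).

End Hyperbolic.

Definition geodesic_space {R : realType} (X : metricType R) : Prop :=
  forall x y : X, exists A, geodesic_segment x y A.

Definition isometric_action {R : realType} (G : groupType) (X : metricType R)
    (act : G -> X -> X) : Prop :=
  [/\ forall x, act 1%g x = x,
      forall g h x, act (g * h)%g x = act g (act h x)
    & forall g x y, mdist (act g x) (act g y) = mdist x y].

Definition quasi_isometric_embedding {R : realType} {S T : Type}
    (dS : S -> S -> R) (dT : T -> T -> R) (f : S -> T) : Prop :=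
  exists lambda c : R, [/\ 1 <= lambda, 0 <= c &
    forall a b, lambda^-1 * dS a b - c <= dT (f a) (f b)
                                       <= lambda * dS a b + c].

Section Tuples.
Context {G : groupType} {n : nat}.
Implicit Types (M N : n.-tuple G) (i j : 'I_n).

(* A word is a sequence of letters (i, b), where b = true stands for the
   inverse of the i-th entry. *)
Definition word_value M (w : seq ('I_n * bool)) : G :=
  (\prod_(l <- w) (if l.2 then (tnth M l.1)^-1 else tnth M l.1))%g.

Definition generates M : Prop := forall g, exists w, word_value M w = g.

Definition word_metric (R : realType) M (a b : G) : R :=
  inf [set (size w)%:R | w in [set w | word_value M w = (a^-1 * b)%g]].

(* Universal property of a free basis. *)
Definition free_on M : Prop :=
  forall (H : groupType) (h : 'I_n -> H),
    exists phi : {multiplicative G -> H},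
      (forall i, phi (tnth M i) = h i) /\
      forall psi : {multiplicative G -> H},
        (forall i, psi (tnth M i) = h i) -> psi =1 phi.

Inductive nielsen_move M : n.-tuple G -> Prop :=
| nielsen_inv i :
    nielsen_move M
      [tuple if k == i then (tnth M i)^-1%g else tnth M k | k < n]
| nielsen_mul i j : i != j ->
    nielsen_move M
      [tuple if k == i then (tnth M i * tnth M j)%g else tnth M k | k < n]
| nielsen_swap i j : i != j ->
    nielsen_move M [tuple tnth M (tperm i j k) | k < n].

Definition nielsen_equivalent M N : Prop :=
  clos_refl_trans (n.-tuple G) nielsen_move M N.

End Tuples.

(* Main.v *)
(* Consider all finite connected graphs of rank n, equivariantly placed in X,
   whose fundamental group is marked by a tuple Nielsen equivalent to M, and take
   one whose total length is within delta of the infimum. Removing vertices of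
   valence at most two bounds the number of edges in terms of n. Hence some gap
   in a fixed sequence of scales separates "short" edges from much longer "long"
   ones. If the short edges contain a cycle, some generator of a Nielsen
   equivalent tuple has small displacement. Otherwise, after exchanging tree
   edges, the short edges lie in the spanning tree. Two distinct long edges
   issuing from the same short component cannot overlap much, since folding them
   would reduce the total length by more than delta. So reduced paths in the
   graph with short components collapsed are local quasi-geodesics, hence global
   ones, which yields freeness and the quasi-isometric embedding. *)

From HB Require Import structures.
Require Import Defs.
From mathcomp Require Import all_boot all_order all_algebra all_fingroup.
From mathcomp Require Import all_classical all_reals.
From mathcomp Require Import topology.
From mathcomp Require Import ring lra zify.
From Stdlib Require Import Relation_Operators.

Set Implicit Arguments.
Unset Strict Implicit.
Unset Printing Implicit Defensive.

Import Order.TTheory GRing.Theory Num.Theory.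

Local Open Scope ring_scope.

(** * The four-point inequality *)

(** Gromov's four-point condition, with the maximum of the two sums written as a disjunction. *)
Definition four_point {R : realType} {X : metricType R} (c : R) : Prop :=
  forall x y z o : X,
    mdist x z + mdist y o <= mdist x y + mdist z o + c \/
    mdist x z + mdist y o <= mdist x o + mdist y z + c.

Section Geometry.
Context {R : realType} {X : metricType R}.
Implicit Types x y z o p : X.

Lemma geodesic_point (x y : X) (s : R) :
  geodesic_space X -> 0 <= s <= mdist x y ->
  exists2 w, mdist x w = s & mdist w y = mdist x y - s.
Proof.
move=> /(_ x y) [A [g [g0 gL giso _]]] /andP[s0 sL].
have i0 : 0 \in `[0, mdist x y] by rewrite in_itv /= lexx mdist_ge0.
have iL : mdist x y \in `[0, mdist x y] by rewrite in_itv /= lexx mdist_ge0.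
have sI : s \in `[0, mdist x y] by rewrite in_itv /= s0.
exists (g s).
- by rewrite -{1}g0 giso // sub0r normrN ger0_norm.
- by rewrite -{1}gL giso // distrC ger0_norm // subr_ge0.
Qed.

Section Slim.
Variable delta : R.
Hypotheses (delta_gt0 : 0 < delta) (Xgeo : geodesic_space X)
  (Xhyp : @hyperbolic R X delta).

Lemma slim_near (x y p : X) (B : set X) :
  geodesic_segment x y B -> neighborhood delta B p ->
  mdist x p + mdist p y <= mdist x y + 2 * delta.
Proof.
have d0 := delta_gt0; move=> [g [g0 gL giso ->]] [_ [s /= si <-] pq].
have i0 : 0 \in `[0, mdist x y] by rewrite in_itv /= lexx mdist_ge0.
have iL : mdist x y \in `[0, mdist x y] by rewrite in_itv /= lexx mdist_ge0.
have e1 : mdist x (g s) = s.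
  rewrite -{1}g0 giso // sub0r normrN ger0_norm //.
  by move: si; rewrite in_itv /= => /andP[].
have e2 : mdist (g s) y = mdist x y - s.
  rewrite -{1}gL giso // distrC ger0_norm // subr_ge0.
  by move: si; rewrite in_itv /= => /andP[].
have := metric_triangle x (g s) p; have := metric_triangle p (g s) y.
rewrite (metric_sym (g s) p); lra.
Qed.

(* Walking along [x, z] in steps of length delta, the last point that is close
   to [x, y] is also close to [y, z]. *)
Lemma slim_center (x z : X) (g : R -> X) :
  g 0 = x -> g (mdist x z) = z ->
  {in `[0, mdist x z] &, forall s t, mdist (g s) (g t) = `|s - t|} ->
  forall y, exists s : R, [/\ 0 <= s <= mdist x z,
    s + mdist (g s) y <= mdist x y + 2 * delta &
    mdist x z - s + mdist (g s) y <= mdist y z + 4 * delta].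
Proof.
move=> g0 gL giso y; set L := mdist x z; have d0 := delta_gt0.
have L0 : 0 <= L by exact: mdist_ge0.
have [A hA] := Xgeo x y; have [B hB] := Xgeo y z.
(* [hyperbolic] wants this side directed from z to y, so the parametrization is reversed. *)
have hB' : geodesic_segment z y B.
  have [h [h0 hL hiso ->]] := hB.
  exists (fun s => h (mdist y z - s)); rewrite (metric_sym z y); split.
  - by rewrite subr0.
  - by rewrite subrr.
  - move=> s t; rewrite !in_itv /= => /andP[s0 sL] /andP[t0 tL].
    rewrite hiso ?in_itv /=; first by rewrite -normrN; congr (`|_|); lra.
      by apply/andP; split; lra.
    by apply/andP; split; lra.
  - apply/seteqP; split=> _ [s /= si <-].
      exists (mdist y z - s); last by congr h; lra.
      by move: si; rewrite /= !in_itv /= => /andP[s0 sL]; apply/andP; split; lra.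
    exists (mdist y z - s) => //.
    by move: si; rewrite /= !in_itv /= => /andP[s0 sL]; apply/andP; split; lra.
pose N1 (s : R) := s + mdist (g s) y <= mdist x y + 2 * delta.
pose N2 (s : R) := L - s + mdist (g s) y <= mdist y z + 2 * delta.
have xg (s : R) : 0 <= s <= L -> mdist x (g s) = s.
  move=> sL; rewrite -{1}g0 giso ?in_itv ?/= ?lexx //.
  by rewrite sub0r normrN ger0_norm //; case/andP: sL.
have zg (s : R) : 0 <= s <= L -> mdist z (g s) = L - s.
  move=> sL; rewrite -{1}gL giso ?in_itv /= ?lexx ?andbT //.
  by rewrite ger0_norm // subr_ge0; case/andP: sL.
have cov (s : R) : 0 <= s <= L -> N1 s \/ N2 s.
  move=> sL.
  have gs : (g @` [set` `[0, L]%R])%classic (g s).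
    by exists s => //; rewrite /= in_itv.
  have hAs := Xhyp (ex_intro _ g (And4 g0 gL giso erefl)) hA hB'.
  have [q [Aq|Bq] gq] := hAs _ gs.
  - left; rewrite /N1 -{1}(xg _ sL); apply: slim_near hA _; by exists q.
  - right; rewrite /N2 -{1}(zg _ sL) (metric_sym y z); apply: slim_near hB' _.
    by exists q.
pose f (j : nat) : R := Order.min (j%:R * delta) L.
have fL j : 0 <= f j <= L.
  by rewrite /f le_min ge_min lexx orbT L0 mulr_ge0 // ltW.
have fS j : f j <= f j.+1 <= f j + delta.
  rewrite /f -natr1 mulrDl mul1r; set r : R := _ * delta.
  case: (leP r L) => r1; case: (leP (r + delta) L) => r2; apply/andP;
    by split; lra.
(* Discrete continuity: otherwise [N1] propagates from x to every sample point, including z, where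
   [N2] holds trivially. *)
have [j [n1 n2]] : exists j, N1 (f j) /\ N2 (f j.+1).
  apply: contrapT => /forallNP noj.
  have all1 j : N1 (f j).
    elim: j => [|j IH].
      by rewrite /N1 /f mul0r min_l // g0; lra.
    have [//|n2] := cov _ (fL j.+1).
    by case: (noj j).
  have [j jL] : exists j, f j = L.
    exists (Num.bound (L / delta)); rewrite /f; apply/min_idPr.
    rewrite -ler_pdivrMr //; apply: ltW; apply: archi_boundP.
    by rewrite divr_ge0 // ltW.
  have jL' : f j.+1 = L.
    by have := fS j; have := fL j.+1; rewrite jL => /andP[_ h1] /andP[h2 _]; lra.
  case: (noj j); split; first exact: all1.
  by rewrite /N2 jL' gL (metric_sym z y); lra.
(* Moving back by one step costs [delta] in the parameter and [delta] in the distance to y, whence 4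
   instead of 2. *)
exists (f j); split=> //.
move: n2; rewrite /N2 => n2; case/andP: (fS j) => f1 f2.
have := metric_triangle (g (f j)) (g (f j.+1)) y.
have : mdist (g (f j)) (g (f j.+1)) <= delta.
  rewrite giso ?in_itv /= ?fL // distrC ger0_norm; lra.
rewrite -/L; lra.
Qed.

(** Go from y to o through their centers g s and g t on [x, z]. If s <= t, use the estimate towards
    z at y and the one towards x at o: the term |s - t| cancels and the errors 4 delta and 2 delta
    add up. The other case exchanges the roles of x and z. *)
Lemma hyperbolic_four_point : @four_point R X (6 * delta).
Proof.
move=> x y z o.
have [A [g [g0 gL giso _]]] := Xgeo x z.
have [s [/andP[s0 sL] s1 s2]] := slim_center g0 gL giso y.
have [t [/andP[t0 tL] t1 t2]] := slim_center g0 gL giso o.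
have gst : mdist (g s) (g t) = `|s - t|.
  by rewrite giso // in_itv /= ?s0 ?t0.
have := metric_triangle y (g s) o; have := metric_triangle (g s) (g t) o.
have d0 := delta_gt0.
rewrite gst (metric_sym y (g s)) (metric_sym z o).
by case: (leP s t) => st; [rewrite ler0_norm|rewrite gtr0_norm]; 
  [move=> ? ?; right; lra|lra|move=> ? ?; left; lra|lra].
Qed.

End Slim.
End Geometry.

(** * Words and Nielsen moves *)

Lemma multiplicative1 {G H : groupType} (phi : {multiplicative G -> H}) :
  phi 1%g = 1%g.
Proof. by apply: (@mulgI _ (phi 1%g)); rewrite -gmulfM !mulg1. Qed.

Lemma multiplicativeV {G H : groupType} (phi : {multiplicative G -> H}) x :
  phi (x^-1)%g = ((phi x)^-1)%g.
Proof.
by apply: (@mulIg _ (phi x)); rewrite -gmulfM !mulVg multiplicative1.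
Qed.

Section Words.
Context {n : nat}.
Implicit Types w : seq ('I_n * bool).

Definition eval_word {H : groupType} (h : 'I_n -> H) w : H :=
  (\prod_(l <- w) (if l.2 then (h l.1)^-1 else h l.1))%g.

Definition word_inv w := rev [seq (l.1, ~~ l.2) | l <- w].

Lemma eval_word_cons {H : groupType} (h : 'I_n -> H) l w :
  eval_word h (l :: w) =
    ((if l.2 then (h l.1)^-1 else h l.1) * eval_word h w)%g.
Proof. by rewrite /eval_word big_cons. Qed.

Lemma eval_word_cat {H : groupType} (h : 'I_n -> H) w1 w2 :
  eval_word h (w1 ++ w2) = (eval_word h w1 * eval_word h w2)%g.
Proof. by rewrite /eval_word big_cat. Qed.

Lemma eval_word_inv {H : groupType} (h : 'I_n -> H) w :
  eval_word h (word_inv w) = ((eval_word h w)^-1)%g.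
Proof.
elim: w => [|[i b] w IH]; first by rewrite /eval_word big_nil invg1.
rewrite /word_inv /= rev_cons -cats1 eval_word_cat IH !eval_word_cons /=.
by rewrite /eval_word big_nil mulg1 invgM; case: b; rewrite //= invgK.
Qed.

Lemma size_word_inv w : size (word_inv w) = size w.
Proof. by rewrite size_rev size_map. Qed.

Lemma word_valueE {G : groupType} (M : n.-tuple G) w :
  word_value M w = eval_word (tnth M) w.
Proof. by []. Qed.

Lemma morph_eval_word {G H : groupType} (phi : {multiplicative G -> H})
    (M : n.-tuple G) w :
  phi (word_value M w) = eval_word (fun i => phi (tnth M i)) w.
Proof.
rewrite word_valueE; elim: w => [|[i b] w IH].
  by rewrite /eval_word !big_nil multiplicative1.
by rewrite !eval_word_cons gmulfM IH /=; case: b; rewrite ?multiplicativeV.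
Qed.

(** The morphism evaluates a chosen word for each element; the hypothesis on trivial words makes the
    value independent of the choice, hence multiplicative. *)
Lemma free_on_words {G : groupType} (M : n.-tuple G) :
  generates M ->
  (forall (H : groupType) (h : 'I_n -> H) w,
     word_value M w = 1%g -> eval_word h w = 1%g) ->
  free_on M.
Proof.
move=> gM rel H h.
pose wd g := projT1 (cid (gM g)).
have wdP g : word_value M (wd g) = g := projT2 (cid (gM g)).
have wd_eq w g : word_value M w = g -> eval_word h (wd g) = eval_word h w.
  move=> wg; apply: divg1_eq.
  rewrite -eval_word_inv -eval_word_cat; apply: rel.
  rewrite word_valueE eval_word_cat eval_word_inv -!word_valueE wdP wg.
  by rewrite mulgV.
pose f g := eval_word h (wd g).
have fM : {morph f : x y / (x * y)%g >-> (x * y)%g}.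
  move=> a b; rewrite /f -eval_word_cat; apply: wd_eq.
  by rewrite word_valueE eval_word_cat -!word_valueE !wdP.
pose F := isMultiplicative.Build G H f fM.
pose phi : {multiplicative G -> H} := HB.pack f F.
exists phi; split.
  move=> i; have -> : phi (tnth M i) = eval_word h [:: (i, false)].
    apply: wd_eq; by rewrite word_valueE eval_word_cons /eval_word big_nil mulg1.
  by rewrite eval_word_cons /eval_word big_nil mulg1.
move=> psi psih g; rewrite -[g in LHS]wdP morph_eval_word.
by apply: eq_bigr => -[i b] _ /=; rewrite psih.
Qed.

End Words.

(** * Nielsen moves: word lengths, freeness, derived moves *)

Section Nielsen.
Context {G : groupType} {n : nat}.
Implicit Types M N : n.-tuple G.

Definition short_words M N :=
  forall i, exists w, word_value M w = tnth N i /\ (size w <= 2)%N.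

Lemma short_words_subst M N (w : seq ('I_n * bool)) : short_words M N ->
  exists w', word_value M w' = word_value N w /\ (size w' <= 2 * size w)%N.
Proof.
move=> sw; elim: w => [|[i b] w [w' [e s]]].
  by exists [::]; rewrite !word_valueE /eval_word !big_nil.
have [u [ue us]] := sw i.
exists ((if b then word_inv u else u) ++ w'); split.
  rewrite !word_valueE eval_word_cat eval_word_cons -!word_valueE e /= -ue.
  by case: b => //; rewrite word_valueE eval_word_inv.
rewrite size_cat /= mulnS leq_add //.
by case: b; rewrite ?size_word_inv.
Qed.

Lemma nielsen_move_short_words M N : nielsen_move M N -> short_words M N.
Proof.
have one k : word_value M [:: (k, false)] = tnth M k.
  by rewrite word_valueE eval_word_cons /eval_word big_nil mulg1.
case=> [i|i j ij|i j ij] k; rewrite tnth_mktuple.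
- case: ifP => _; last by exists [:: (k, false)].
  exists [:: (i, true)]; split=> //.
  by rewrite word_valueE eval_word_cons /eval_word big_nil mulg1.
- case: ifP => _; last by exists [:: (k, false)].
  exists [:: (i, false); (j, false)]; split=> //.
  by rewrite word_valueE !eval_word_cons /eval_word big_nil mulg1.
- by exists [:: (tperm i j k, false)].
Qed.

(** [nielsen_equivalent] is a closure of moves in one direction, so the reverse substitution is
    given separately; it carries generation from M to N. *)
Lemma nielsen_move_short_wordsV M N : nielsen_move M N -> short_words N M.
Proof.
have one N' k : word_value N' [:: (k, false)] = tnth N' k.
  by rewrite word_valueE eval_word_cons /eval_word big_nil mulg1.
case=> [i|i j ij|i j ij] k.
- have [->|ki] := eqVneq k i.
    exists [:: (i, true)]; split=> //.
    rewrite word_valueE eval_word_cons /eval_word big_nil mulg1 /=.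
    by rewrite tnth_mktuple eqxx invgK.
  by exists [:: (k, false)]; rewrite one tnth_mktuple (negbTE ki).
- have [->|ki] := eqVneq k i.
    exists [:: (i, false); (j, true)]; split=> //.
    rewrite word_valueE !eval_word_cons /eval_word big_nil mulg1 /=.
    by rewrite !tnth_mktuple eqxx eq_sym (negbTE ij) mulgK.
  by exists [:: (k, false)]; rewrite one tnth_mktuple (negbTE ki).
- by exists [:: (tperm i j k, false)]; rewrite one tnth_mktuple tpermK.
Qed.

(** Values prescribed on M determine values on N; cancelling in H recovers those on M, and
    uniqueness carries over in the same way. *)
Lemma nielsen_move_free M N : nielsen_move M N -> free_on N -> free_on M.
Proof.
case=> [i|i j ij|i j ij] fN H h.
- have [phi [phiN phiU]] :=
    fN H (fun k => if k == i then (h i)^-1%g else h k).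
  have phiM k : phi (tnth M k) = h k.
    have := phiN k; rewrite tnth_mktuple; case: eqP => // ->.
    by rewrite multiplicativeV => /invg_inj.
  exists phi; split=> // psi psiM; apply: phiU => k.
  by rewrite tnth_mktuple; case: eqP => // _; rewrite multiplicativeV psiM.
- have [phi [phiN phiU]] :=
    fN H (fun k => if k == i then (h i * h j)%g else h k).
  have phij : phi (tnth M j) = h j.
    by have := phiN j; rewrite tnth_mktuple eq_sym (negbTE ij).
  have phiM k : phi (tnth M k) = h k.
    have := phiN k; rewrite tnth_mktuple; case: eqP => // ->.
    by rewrite gmulfM phij => /mulIg.
  exists phi; split=> // psi psiM; apply: phiU => k.
  by rewrite tnth_mktuple; case: eqP => // _; rewrite gmulfM !psiM.
- have [phi [phiN phiU]] := fN H (fun k => h (tperm i j k)).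
  exists phi; split=> [k|psi psiM].
    by have := phiN (tperm i j k); rewrite tnth_mktuple tpermK.
  by apply: phiU => k; rewrite tnth_mktuple psiM.
Qed.

Lemma nielsen_equivalent_free M N :
  nielsen_equivalent M N -> free_on N -> free_on M.
Proof. by elim=> [A B /nielsen_move_free||A B C _ AB _ BC /BC/AB]. Qed.

Lemma nielsen_equivalent_generates M N :
  nielsen_equivalent M N -> generates M -> generates N.
Proof.
elim=> [A B /nielsen_move_short_wordsV sw gA g||A B C _ AB _ BC /AB/BC] //.
have [w <-] := gA g; have [w' [e _]] := short_words_subst w sw.
by exists w'.
Qed.

(** The linear bound will be proved for the labels of a graph and must be brought back to M; each
    move doubles K. *)
Lemma nielsen_equivalent_length {R : realType} (l : G -> R) M N :
  nielsen_equivalent M N ->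
  (exists K, forall g, exists2 w, word_value N w = g & (size w)%:R <= K * l g) ->
  exists K, forall g, exists2 w, word_value M w = g & (size w)%:R <= K * l g.
Proof.
elim=> [A B /nielsen_move_short_words sw [K hK]||A B C _ AB _ BC /BC/AB] //.
exists (2 * K) => g; have [w wg ws] := hK g.
have [w' [e s]] := short_words_subst w sw.
exists w'; rewrite ?e //; rewrite -mulrA.
apply: le_trans (_ : (2 * size w)%:R <= _); first by rewrite ler_nat.
by rewrite natrM ler_pM2l.
Qed.

Lemma nielsen_equivalent_refl M : nielsen_equivalent M M.
Proof. exact: rt_refl. Qed.

Lemma nielsen_equivalent_trans M N P :
  nielsen_equivalent M N -> nielsen_equivalent N P -> nielsen_equivalent M P.
Proof. exact: rt_trans. Qed.

Definition tuple_set M (i : 'I_n) (g : G) :=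
  [tuple if k == i then g else tnth M k | k < n].

Lemma nielsen_mulr M i j : i != j ->
  nielsen_equivalent M (tuple_set M i (tnth M i * tnth M j)%g).
Proof. by move=> ij; apply: rt_step; exact: nielsen_mul. Qed.

Lemma nielsen_invi M i : nielsen_equivalent M (tuple_set M i (tnth M i)^-1%g).
Proof. by apply: rt_step; exact: nielsen_inv. Qed.

(** Conjugate right multiplication by the inversion of the j-th entry. *)
Lemma nielsen_divr M i j : i != j ->
  nielsen_equivalent M (tuple_set M i (tnth M i * (tnth M j)^-1)%g).
Proof.
move=> ij; apply: nielsen_equivalent_trans (nielsen_invi M j) _.
apply: nielsen_equivalent_trans (nielsen_mulr _ ij) _.
apply: nielsen_equivalent_trans (nielsen_invi _ j) _.
set T := tuple_set _ _ _; set T' := tuple_set _ _ _.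
suff -> : T = T' by exact: nielsen_equivalent_refl.
have ji : (j == i) = false by rewrite eq_sym (negbTE ij).
apply: eq_from_tnth => k; rewrite !tnth_mktuple !eqxx ji (negbTE ij).
have [->|kj] := eqVneq k j; first by rewrite ji invgK.
by [].
Qed.

Lemma nielsen_mull M i j : i != j ->
  nielsen_equivalent M (tuple_set M i (tnth M j * tnth M i)%g).
Proof.
move=> ij; apply: nielsen_equivalent_trans (nielsen_invi M i) _.
apply: nielsen_equivalent_trans (nielsen_divr _ ij) _.
apply: nielsen_equivalent_trans (nielsen_invi _ i) _.
set T := tuple_set _ _ _; set T' := tuple_set _ _ _.
suff -> : T = T' by exact: nielsen_equivalent_refl.
have ji : (j == i) = false by rewrite eq_sym (negbTE ij).
apply: eq_from_tnth => k; rewrite !tnth_mktuple !eqxx ji.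
by case: eqVneq => // _; rewrite invgM !invgK.
Qed.

(* The effect on a tuple of a change of gauge by [tnth M i] on one side of a
   cut: each other generator is multiplied according to the sides of its ends. *)
Lemma nielsen_gauge M i (a b : 'I_n -> bool) :
  nielsen_equivalent M
    [tuple if k == i then tnth M i else
      ((if a k then tnth M i else 1) * tnth M k *
       (if b k then (tnth M i)^-1 else 1))%g | k < n].
Proof.
(* [T s] makes the change only at the indices in s, at the cost of at most two multiplications per
   index. *)
pose T (s : seq 'I_n) := [tuple if (k != i) && (k \in s) then
      ((if a k then tnth M i else 1) * tnth M k *
       (if b k then (tnth M i)^-1 else 1))%g else tnth M k | k < n].
suff h s : uniq s -> nielsen_equivalent M (T s).
  have := h (enum 'I_n) (enum_uniq _).
  congr nielsen_equivalent; apply: eq_from_tnth => k; rewrite !tnth_mktuple.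
  by rewrite mem_enum andbT; case: eqVneq => // ->.
elim: s => [_|j s IH /= /andP[js /IH]].
  suff -> : T [::] = M by exact: nielsen_equivalent_refl.
  by apply: eq_from_tnth => k; rewrite tnth_mktuple andbF.
move/nielsen_equivalent_trans; apply.
have [ji|ji] := eqVneq j i.
  suff -> : T (j :: s) = T s by exact: nielsen_equivalent_refl.
  apply: eq_from_tnth => k; rewrite !tnth_mktuple in_cons ji.
  by case: eqVneq.
have Ti : tnth (T s) i = tnth M i by rewrite tnth_mktuple eqxx.
have Tj : tnth (T s) j = tnth M j by rewrite tnth_mktuple (negbTE js) andbF.
pose U := if a j then tuple_set (T s) j (tnth (T s) i * tnth (T s) j)%g else T s.
have TU : nielsen_equivalent (T s) U.
  rewrite /U; case: (a j); last exact: nielsen_equivalent_refl.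
  exact: nielsen_mull.
have Ui : tnth U i = tnth M i.
  by rewrite /U; case: (a j); rewrite // [LHS]tnth_mktuple eq_sym (negbTE ji).
have Uj : tnth U j = ((if a j then tnth M i else 1) * tnth M j)%g.
  rewrite /U; case: (a j); last by rewrite Tj mul1g.
  by rewrite [LHS]tnth_mktuple eqxx Ti Tj.
have Uk k : k != j -> tnth U k = tnth (T s) k.
  move=> /negbTE kj; rewrite /U; case: (a j) => //.
  by rewrite [LHS]tnth_mktuple kj.
apply: nielsen_equivalent_trans TU _.
pose V := if b j then tuple_set U j (tnth U j * (tnth U i)^-1)%g else U.
have UV : nielsen_equivalent U V.
  rewrite /V; case: (b j); last exact: nielsen_equivalent_refl.
  exact: nielsen_divr.
suff <- : V = T (j :: s) by [].
apply: eq_from_tnth => k; have [->|kj] := eqVneq k j.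
  rewrite [RHS]tnth_mktuple in_cons eqxx ji /= /V.
  case: (b j); last by rewrite Uj mulg1.
  by rewrite [LHS]tnth_mktuple eqxx Uj Ui.
have <- : tnth (T s) k = tnth V k.
  by rewrite /V -Uk //; case: (b j); rewrite // [RHS]tnth_mktuple (negbTE kj).
by rewrite [LHS]tnth_mktuple [RHS]tnth_mktuple in_cons (negbTE kj).
Qed.

End Nielsen.

(** * From displacement bounds to quasi-isometric embeddings *)

Section WordMetric.
Context {R : realType} {G : groupType} {X : metricType R} {n : nat}.
Variables (act : G -> X -> X) (M : n.-tuple G).
Hypotheses (actI : isometric_action act) (gM : generates M).

Lemma isometric_word_upper (x : X) : exists2 D : R, 1 <= D &
  forall w, mdist x (act (word_value M w) x) <= D * (size w)%:R.
Proof.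
have [act1 actM iso] := actI.
pose D := 1 + \sum_i mdist x (act (tnth M i) x).
have Di i : mdist x (act (tnth M i) x) <= D.
  rewrite /D (bigD1 i) //= addrCA lerDl addr_ge0 //.
  by apply: sumr_ge0 => *; exact: mdist_ge0.
exists D.
  by rewrite /D lerDl; apply: sumr_ge0 => *; exact: mdist_ge0.
elim=> [|[i b] w IH].
  by rewrite word_valueE /eval_word big_nil act1 mdistxx mulr0.
rewrite word_valueE eval_word_cons -word_valueE actM /= -natr1 mulrDr mulr1.
rewrite addrC; set h := if b then _ else _.
apply: le_trans (metric_triangle _ (act h x) _) _; rewrite iso lerD //.
rewrite /h; case: b {h} => //.
by rewrite -(iso (tnth M i)) -actM mulgV act1 metric_sym.
Qed.

(** A lower bound along one orbit suffices: passing from x0 to x changes displacements by at most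
    twice the distance of the base points. The upper bound comes from the displacements of the
    generators. *)
Lemma quasi_isometric_embedding_words (x0 : X) :
  (exists K, forall g,
     exists2 w, word_value M w = g & (size w)%:R <= K * (1 + mdist x0 (act g x0))) ->
  forall x, quasi_isometric_embedding (word_metric R M) (@mdist R X)
    (fun h => act h x).
Proof.
move=> [K0 hK0] x; have [act1 actM iso] := actI.
have [D D1 hD] := isometric_word_upper x.
pose K := 1 + `|K0|.
have K1 : 1 <= K by rewrite lerDl.
have hK g : exists2 w, word_value M w = g &
    (size w)%:R <= K * (1 + mdist x0 (act g x0)).
  have [w wg ws] := hK0 g; exists w => //; apply: le_trans ws _.
  rewrite ler_wpM2r ?addr_ge0 ?mdist_ge0 // /K.
  by have := ler_norm K0; lra.
pose L := K + D; pose c := 1 + 2 * mdist x0 x.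
have d0 : 0 <= mdist x0 x by exact: mdist_ge0.
exists L, c; split; [by rewrite /L; lra|by rewrite /c; lra|].
move=> a b; set g := (a^-1 * b)%g.
have -> : mdist (act a x) (act b x) = mdist x (act g x).
  by rewrite -[RHS](iso a) /g -actM mulVKg.
pose E := [set ((size w)%:R : R) | w in [set w | word_value M w = g]]%classic.
have -> : word_metric R M a b = inf E by [].
have lbE : lbound E 0 by move=> _ [w _ <-]; exact: ler0n.
have E0 : (E !=set0)%classic.
  by have [w wg] := gM g; exists (size w)%:R; exists w.
have L0 : 0 < L by rewrite /L; lra.
have i0 : 0 <= inf E by apply: lb_le_inf.
apply/andP; split; last first.
  apply: le_trans (_ : L * inf E <= _); last by rewrite lerDl /c; lra.
  rewrite -ler_pdivrMl //; apply: lb_le_inf => // _ [w /= wg <-].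
  rewrite ler_pdivrMl // -wg; apply: le_trans (hD w) _.
  by rewrite ler_wpM2r // /L; lra.
have [w wg ws] := hK g.
have iw : inf E <= (size w)%:R by apply: ge_inf; [exists 0|exists w].
have tri : mdist x0 (act g x0) <= mdist x (act g x) + 2 * mdist x0 x.
  have := metric_triangle x0 x (act g x0).
  have := metric_triangle x (act g x) (act g x0).
  by rewrite iso (metric_sym x x0); lra.
rewrite lerBlDr mulrC ler_pdivrMr //.
apply: le_trans iw _; apply: le_trans ws _.
apply: le_trans (_ : K * (c + mdist x (act g x)) <= _).
  by rewrite ler_pM2l; [rewrite /c; lra|lra].
rewrite mulrC addrC ler_wpM2l ?addr_ge0 ?mdist_ge0 // /L /c; lra.
Qed.

End WordMetric.

(** * Marked graphs *)

Section MarkedGraph.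
Context {R : realType} {G : groupType} {X : metricType R} {n : nat}.
Variable act : G -> X -> X.
Hypothesis actI : isometric_action act.

Local Notation edge k := ('I_k + 'I_n)%type.
Local Notation dart k := (('I_k + 'I_n) * bool)%type.

(* A finite connected graph with k + 1 vertices, placed in X. The edges [inl t]
   form a spanning tree and carry the trivial label; the edge [inr i] carries
   the i-th generator g and joins the point of its source to the translate by g
   of the point of its target. *)
Record marked_graph k := MarkedGraph {
  src : dart k -> 'I_k.+1;
  pos : 'I_k.+1 -> X;
  lab : n.-tuple G }.

Definition edge_label {H : groupType} {k} (h : 'I_n -> H) (e : edge k) : H :=
  if e is inr i then h i else 1%g.

Definition holonomy {H : groupType} {k} (h : 'I_n -> H) (d : dart k) : H :=
  if d.2 then (edge_label h d.1)^-1%g else edge_label h d.1.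

Definition opp_dart {k} (d : dart k) : dart k := (d.1, ~~ d.2).

(** The end of the lift of [d] to X that starts at the point of its source. *)
Definition far k (Q : marked_graph k) (d : dart k) : X :=
  act (holonomy (tnth (lab Q)) d) (pos Q (src Q (opp_dart d))).

Definition len k (Q : marked_graph k) (e : edge k) : R :=
  mdist (pos Q (src Q (e, false))) (far Q (e, false)).

Definition cost k (Q : marked_graph k) : R := \sum_e len Q e.

(* Connectedness of the tree edges, in terms of vertex sets. *)
Definition tree_connected k (Q : marked_graph k) : Prop :=
  forall P : 'I_k.+1 -> bool,
    (forall t, P (src Q (inl t, false)) = P (src Q (inl t, true))) ->
    forall u v, P u = P v.

(** The edge [t] is a bridge of the spanning tree, and [P] is one of the two sides left by its
    removal. *)
Definition separates k (Q : marked_graph k) (t : 'I_k) (P : 'I_k.+1 -> bool) :=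
  P (src Q (inl t, false)) <> P (src Q (inl t, true)) /\
  forall s, s != t -> P (src Q (inl s, false)) = P (src Q (inl s, true)).

Lemma holonomy_opp {H : groupType} {k} (h : 'I_n -> H) (d : dart k) :
  holonomy h (opp_dart d) = (holonomy h d)^-1%g.
Proof. by case: d => e []; rewrite /holonomy //= invgK. Qed.

Lemma opp_dartK k : involutive (@opp_dart k).
Proof. by case=> e b; rewrite /opp_dart /= negbK. Qed.

Lemma mdist_far k (Q : marked_graph k) d :
  mdist (pos Q (src Q d)) (far Q d) = len Q d.1.
Proof.
have [act1 actM iso] := actI; case: d => e [] //=.
rewrite /len /far /holonomy /opp_dart /= -(iso (edge_label (tnth (lab Q)) e)).
by rewrite -actM mulgV act1 metric_sym.
Qed.

Lemma len_ge0 k (Q : marked_graph k) e : 0 <= len Q e.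
Proof. exact: mdist_ge0. Qed.

Lemma cost_ge0 k (Q : marked_graph k) : 0 <= cost Q.
Proof. by apply: sumr_ge0 => e _; exact: len_ge0. Qed.

(** If no cut is crossed by t alone, the other tree edges already connect the graph, and t can be
    replaced by a loop of length zero at [ord0]. *)
Lemma bridge_or_shorten k (Q : marked_graph k) t : tree_connected Q ->
  (exists P, separates Q t P) \/
  exists Q' : marked_graph k,
    [/\ tree_connected Q', lab Q' = lab Q & cost Q' = cost Q - len Q (inl t)].
Proof.
have [act1 actM iso] := actI.
move=> conn; have [|noP] := pselect (exists P, separates Q t P); first by left.
right; pose Q' := MarkedGraph
  (fun d => if d.1 == inl t then ord0 else src Q d) (pos Q) (lab Q).
exists Q'; split=> //.
- move=> P inv; apply: conn => s; have := inv s.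
  rewrite /Q' /=; case: eqVneq => [[->] _|//].
  apply: contrapT => Pt; case: noP; exists P; split=> // r rt.
  have := inv r; rewrite /Q' /=; case: eqVneq => // -[e].
  by rewrite e eqxx in rt.
- rewrite /cost (bigD1 (inl t)) //= [in RHS](bigD1 (inl t)) //= addrAC subrr.
  rewrite /len /far /Q' /= eqxx /holonomy /= act1 mdistxx !add0r.
  by apply: eq_bigr => e /negbTE et; rewrite et.
Qed.

(** Counting darts: valence at least 3 everywhere would give 3 (k + 1) <= 2 (k + n). *)
Lemma exists_low_degree k (Q : marked_graph k) : (n * 2 < k + 3)%N ->
  exists v, (\sum_(d : dart k) (src Q d == v) <= 2)%N.
Proof.
move=> nk; apply: contrapT => /forallNP high.
have : (\sum_(v : 'I_k.+1) \sum_(d : dart k) (src Q d == v) =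
        \sum_(d : dart k) 1)%N.
  rewrite exchange_big; apply: eq_bigr => d _ /=.
  rewrite (bigD1 (src Q d)) //= eqxx big1 ?addn0 // => v.
  by rewrite eq_sym => /negbTE ->.
have : (\sum_(v : 'I_k.+1) 3 <=
        \sum_(v : 'I_k.+1) \sum_(d : dart k) (src Q d == v))%N.
  by apply: leq_sum => v _; rewrite ltnNge; apply/negP; exact: high.
rewrite !sum_nat_const !card_prod card_sum !card_ord card_bool => h1 h2.
by move: h1; rewrite h2; lia.
Qed.

(** Slide v along a tree edge t to its other end u. The length of t is saved, and at most one
    further dart issues from v, which grows by at most that length. *)
Lemma contract_vertex k (Q : marked_graph k.+1) v : tree_connected Q ->
  (\sum_(d : dart k.+1) (src Q d == v) <= 2)%N ->
  exists Q' : marked_graph k,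
    [/\ tree_connected Q', lab Q' = lab Q & cost Q' <= cost Q].
Proof.
have [act1 actM iso] := actI.
move=> conn deg2.
have [t [b [tv tu]]] :
    exists t b, src Q (inl t, b) = v /\ src Q (inl t, ~~ b) != v.
  apply: contrapT => not_t.
  suff inv t : (src Q (inl t, false) == v) = (src Q (inl t, true) == v).
    have [u uv] : exists u, u != v by exists (lift v ord0); rewrite eq_sym neq_lift.
    by have /= := conn (fun w => w == v) inv u v; rewrite eqxx (negbTE uv).
  case: eqVneq => [e0|e0]; case: eqVneq => // e1; case: not_t.
    by exists t, false.
  by exists t, true.
set u := src Q (inl t, ~~ b) in tu.
pose psi w := if w == v then u else w.
have psiv w : psi w != v by rewrite /psi; case: ifPn.
pose phi w : 'I_k.+1 := odflt ord0 (unlift v (psi w)).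
have phiK w : lift v (phi w) = psi w.
  rewrite /phi; case: unliftP => [j e|e]; first by rewrite e.
  by have := psiv w; rewrite e eqxx.
pose le (e : edge k) : edge k.+1 :=
  match e with inl s => inl (lift t s) | inr i => inr i end.
pose Q' := MarkedGraph (fun d : dart k => phi (src Q (le d.1, d.2)))
  (fun w => pos Q (lift v w)) (lab Q).
exists Q'; split=> //.
- move=> P inv.
  have phil w : phi (lift v w) = w.
    apply: (@lift_inj _ v); rewrite phiK /psi.
    by rewrite eq_sym (negbTE (neq_lift _ _)).
  have inv' s : P (phi (src Q (inl s, false))) = P (phi (src Q (inl s, true))).
    case: (unliftP t s) => [r ->|->]; first exact: inv.
    have phivu : phi v = phi u.
      apply: (@lift_inj _ v); rewrite !phiK /psi eqxx; by case: ifP.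
    by move: tv phivu; rewrite /u; case: (b) => /= -> ->.
  move=> x y; rewrite -(phil x) -(phil y).
  exact: (conn (fun w => P (phi w)) inv').
- pose D := mdist (pos Q v) (pos Q u).
  have lenD : len Q (inl t) = D.
    by rewrite -(mdist_far Q (inl t, b)) /far /opp_dart tv /holonomy /= invg1 if_same act1.
  have dpsi w : mdist (pos Q (psi w)) (pos Q w) <= (w == v)%:R * D.
    rewrite /psi; case: eqVneq => [->|_]; rewrite ?mul1r ?mul0r ?mdistxx //.
    by rewrite metric_sym.
  (* The number of ends of e at v: the total is at most 2, and t takes at least one of them. *)
  pose m (e : edge k.+1) : nat := (\sum_(c : bool) (src Q (e, c) == v))%N.
  have lele e : len Q' e <= len Q (le e) + (m (le e))%:R * D.
    rewrite /m big_bool /= natrD mulrDl /len /far /Q' /= !phiK /holonomy /=.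
    have -> : edge_label (tnth (lab Q)) e = edge_label (tnth (lab Q)) (le e).
      by case: e.
    set p := src Q (le e, false); set q := src Q (le e, true); set h := edge_label _ _.
    have := dpsi p; have := dpsi q; rewrite -(iso h).
    have := metric_triangle (pos Q (psi p)) (pos Q p) (act h (pos Q (psi q))).
    have := metric_triangle (pos Q p) (act h (pos Q q)) (act h (pos Q (psi q))).
    rewrite (metric_sym (act h (pos Q q)) _); lra.
  have sum_le (F : edge k.+1 -> R) : \sum_e F e = F (inl t) + \sum_e F (le e).
    by rewrite !big_sumType /= (bigD1_ord t) //= addrA.
  have mt : (1 <= m (inl t))%N.
    by rewrite /m (bigD1 b) //= tv eqxx.
  have msum : \sum_e (m e)%:R <= (2 : R).
    rewrite -natr_sum ler_nat; apply: leq_trans deg2.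
    by rewrite /m pair_bigA /=; apply: leq_sum => -[].
  have D0 : 0 <= D by exact: mdist_ge0.
  rewrite [leRHS]/cost sum_le lenD.
  apply: le_trans (_ : \sum_e (len Q (le e) + (m (le e))%:R * D) <= _).
    by apply: ler_sum.
  rewrite big_split /= addrC lerD2r -mulr_suml.
  move: msum; rewrite sum_le => msum.
  apply: le_trans (_ : 1 * D <= _); last by rewrite mul1r.
  rewrite ler_wpM2r //.
  have : (1 : R) <= (m (inl t))%:R by rewrite ler1n.
  lra.
Qed.

(** The loop edge i crosses the cut of t, so i can replace t in the tree. Translating the side of
    the cut away from the source of i by the label f of i makes the label of i trivial and gives t
    the label f or its inverse; lengths are unchanged because the action is isometric. *)
Lemma exchange_edges k (Q : marked_graph k) t i P : tree_connected Q ->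
  separates Q t P -> P (src Q (inr i, false)) <> P (src Q (inr i, true)) ->
  exists Q' : marked_graph k,
    [/\ tree_connected Q', nielsen_equivalent (lab Q) (lab Q')
      & forall e, len Q' e = len Q (tperm (inl t) (inr i) e)].
Proof.
have [act1 actM iso] := actI.
move=> conn [Pt Pcut] Pi.
set f := tnth (lab Q) i; set p := src Q (inr i, false).
pose far_side u := P u != P p.
pose g u := if far_side u then f else 1%g.
have gV u : (g u)^-1%g = if far_side u then f^-1%g else 1%g.
  by rewrite /g; case: ifP; rewrite ?invg1.
pose lab' := [tuple if j == i
  then (g (src Q (inl t, false)) * (g (src Q (inl t, true)))^-1)%g
  else (g (src Q (inr j, false)) * tnth (lab Q) j *
        (g (src Q (inr j, true)))^-1)%g | j < n].
pose sw : {perm edge k} := tperm (inl t) (inr i).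
pose Q' := MarkedGraph (fun d : dart k => src Q (sw d.1, d.2))
  (fun u => act (g u) (pos Q u)) lab'.
(* A label a becomes g(source) a g(target)^-1. Tree edges other than t keep the trivial label since
   they do not cross the cut. *)
have gauge e : (edge_label (tnth lab') e * g (src Q (sw e, true)))%g =
    (g (src Q (sw e, false)) * edge_label (tnth (lab Q)) (sw e))%g.
  case: e => [s|j]; rewrite /sw permE /=.
  - case: (eqVneq s t) => [->|st]; rewrite /= ?eqxx /=.
      rewrite mul1g -/f -/p /g /far_side eqxx mul1g.
      by case: eqVneq => // /esym.
    case: eqVneq => [[e]|_]; first by rewrite e eqxx in st.
    by rewrite mul1g mulg1 /g /far_side Pcut.
  - rewrite tnth_mktuple; case: (eqVneq j i) => [->|ji] /=; rewrite ?eqxx /=.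
      by rewrite mulgVK mulg1.
    case: eqVneq => [[e]|_]; first by rewrite e eqxx in ji.
    by rewrite mulgVK.
exists Q'; split.
- move=> P' inv.
  (* Correcting P' by the cut P when P' jumps along t gives a function constant on the old tree. As
     i crosses the cut and P' agrees at its ends, there was no jump. *)
  pose P1 u := P' u (+) ((P' (src Q (inl t, false)) != P' (src Q (inl t, true)))
                         && P u).
  have inv1 s : P1 (src Q (inl s, false)) = P1 (src Q (inl s, true)).
    rewrite /P1; case: (eqVneq s t) => [->|st].
      move: Pt; do 2![case: (P' _)]; do 2![case: (P _)] => //=.
    have := inv s; rewrite /Q' /= /sw permE /=.
    case: eqVneq => [[e]|_ ->]; first by rewrite e eqxx in st.
    by rewrite Pcut.
  have := conn P1 inv1 (src Q (inr i, false)) (src Q (inr i, true)).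
  have := inv t; rewrite /Q' /= /sw tpermL /P1 => ->.
  case: eqVneq => [tt _|_].
    apply: conn => s; case: (eqVneq s t) => [-> //|st].
    have := inv1 s; rewrite /P1 tt eqxx /= !addbF; exact.
  by move=> /= /addbI /Pi.
- apply: nielsen_equivalent_trans (nielsen_gauge _ i
    (fun j => far_side (src Q (inr j, false)))
    (fun j => far_side (src Q (inr j, true)))) _.
  set T := [tuple _ | k < n]; rewrite /Q' /=.
  (* The end of t on the far side decides whether its label is f or the inverse of f; the latter
     takes one more inversion. *)
  have [ts|ts] := boolP (far_side (src Q (inl t, false))).
  + suff -> : T = lab' by exact: nielsen_equivalent_refl.
    apply: eq_from_tnth => j; rewrite !tnth_mktuple -/f.
    case: eqVneq => [_|ji]; last by rewrite gV.
    rewrite /g ts; case: ifP => [ts'|_]; last by rewrite invg1 mulg1.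
    by move: Pt ts ts'; rewrite /far_side; do 3![case: (P _)].
  + suff -> : lab' = tuple_set T i (tnth T i)^-1%g by exact: nielsen_invi.
    apply: eq_from_tnth => j; rewrite !tnth_mktuple eqxx -/f.
    case: eqVneq => [_|ji]; last by rewrite gV.
    rewrite /g (negbTE ts); case: ifP => [_|ts']; first by rewrite mul1g.
    by move: Pt ts ts'; rewrite /far_side; do 3![case: (P _)].
- move=> e; by rewrite /len /far /Q' /= /holonomy /= -actM gauge actM iso.
Qed.

(** The darts a and b are detached from their sources and attached to a new vertex placed at w,
    joined to v by a new tree edge. The hypothesis on P says that both sources are still connected
    to v without the edges of a and b. *)
Lemma fold_graph k (Q : marked_graph k) a b v w : tree_connected Q ->
  (forall P : 'I_k.+1 -> bool,
    (forall s, inl s != a.1 -> inl s != b.1 ->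
       P (src Q (inl s, false)) = P (src Q (inl s, true))) ->
    P (src Q a) = P v /\ P (src Q b) = P v) ->
  let y d := if (d == a) || (d == b) then w else pos Q (src Q d) in
  exists Q' : marked_graph k.+1,
    [/\ tree_connected Q', lab Q' = lab Q & cost Q' = mdist (pos Q v) w +
      \sum_e mdist (y (e, false)) (act (edge_label (tnth (lab Q)) e) (y (e, true)))].
Proof.
have [act1 actM iso] := actI.
move=> conn abv y.
(* The new vertex and the new tree edge are numbered [ord0]; the old ones are shifted by [lift]. *)
pose s1 d := if (d == a) || (d == b) then ord0 else lift ord0 (src Q d).
pose src' (d : dart k.+1) := match d.1 with
  | inl t => if unlift ord0 t is Some s then s1 (inl s, d.2)
             else if d.2 then ord0 else lift ord0 v
  | inr i => s1 (inr i, d.2) end.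
pose pos' z := if unlift ord0 z is Some u then pos Q u else w.
exists (MarkedGraph src' pos' (lab Q)); split=> //.
- move=> P inv.
  have Pv : P (lift ord0 v) = P ord0.
    by have := inv ord0; rewrite /src' /= unlift_none.
  have invl s : P (s1 (inl s, false)) = P (s1 (inl s, true)).
    by have := inv (lift ord0 s); rewrite /src' /= liftK.
  have [Pa Pb] : P (lift ord0 (src Q a)) = P (lift ord0 v) /\
                 P (lift ord0 (src Q b)) = P (lift ord0 v).
    apply: (abv (fun u => P (lift ord0 u))) => s sa sb.
    have := invl s; rewrite /s1.
    have ne c d : inl s != d.1 -> ((inl s, c) == d :> dart k) = false.
      by move=> sd; apply/eqP => e; rewrite -e eqxx in sd.
    by rewrite !ne.
  have Ps1 d : P (s1 d) = P (lift ord0 (src Q d)).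
    rewrite /s1; case: eqVneq => [->|_] /=; first by rewrite Pa Pv.
    by case: eqVneq => [->|_] //; rewrite Pb Pv.
  have Pc u u' : P (lift ord0 u) = P (lift ord0 u').
    apply: (conn (fun u => P (lift ord0 u))) => s; by rewrite -!Ps1.
  have P0 z : P z = P ord0.
    by case: (unliftP ord0 z) => [z' ->|-> //]; rewrite -Pv.
  by move=> z z'; rewrite !P0.
- have p1 d : pos' (s1 d) = y d.
    by rewrite /pos' /s1 /y; case: ifP; rewrite ?unlift_none ?liftK.
  rewrite /cost !big_sumType /= big_ord_recl /= -addrA; congr (_ + (_ + _)).
  + rewrite /len /far /holonomy /src' /= unlift_none /pos' liftK unlift_none.
    by rewrite act1.
  + apply: eq_bigr => s _.
    by rewrite /len /far /holonomy /src' /= liftK !p1.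
  + by apply: eq_bigr => i _; rewrite /len /far /holonomy /src' /= !p1.
Qed.

End MarkedGraph.

(** * Folding and short components *)

Section Scales.
Context {R : realType} {G : groupType} {X : metricType R} {n : nat}.
Variables (act : G -> X -> X) (c : R).
Hypotheses (actI : isometric_action act) (Xgeo : geodesic_space X)
  (X4 : @four_point R X c).

Local Notation edge k := ('I_k + 'I_n)%type.
Local Notation dart k := (('I_k + 'I_n) * bool)%type.
Local Notation marked_graph := (@marked_graph R G X n).
Local Notation len := (len act).
Local Notation cost := (cost act).
Local Notation far := (far act).

(** The last hypothesis says that the Gromov product of the far ends is at least s, so a and b share
    an initial piece of length s up to errors in E and c. Folding it shortens both darts by about s
    and adds one edge of length s. *)
Lemma fold_cost k (Q : marked_graph k) a b (E s : R) :
  tree_connected Q -> a != b ->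
  (forall P : 'I_k.+1 -> bool,
    (forall t, inl t != a.1 -> inl t != b.1 ->
       P (src Q (inl t, false)) = P (src Q (inl t, true))) ->
    P (src Q a) = P (src Q b)) ->
  mdist (pos Q (src Q a)) (pos Q (src Q b)) <= E ->
  0 <= s -> 2 * s <= len Q a.1 -> 2 * s <= len Q b.1 ->
  2 * s <= mdist (pos Q (src Q b)) (far Q a) + mdist (pos Q (src Q b)) (far Q b)
           - mdist (far Q a) (far Q b) ->
  exists Q' : marked_graph k.+1,
    [/\ tree_connected Q', lab Q' = lab Q
      & cost Q' <= cost Q - s + 6 * E + 6 * c].
Proof.
have [act1 actM iso] := actI.
move=> conn ab abc abE s0 sa sb sab.
set v := src Q b in abE sab *.
have mb : mdist (pos Q v) (far Q b) = len Q b.1 by exact: mdist_far.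
have c0 : 0 <= c.
  by have := X4 (pos Q v) (pos Q v) (pos Q v) (pos Q v); rewrite mdistxx; lra.
have E0 : 0 <= E by apply: le_trans (mdist_ge0 _ _) abE.
have [w vw wb] : exists2 w, mdist (pos Q v) w = s &
    mdist w (far Q b) = len Q b.1 - s.
  by rewrite -mb; apply: geodesic_point => //; rewrite mb s0 /=; lra.
have va : mdist (pos Q v) (far Q a) <= len Q a.1 + E.
  have := metric_triangle (pos Q v) (pos Q (src Q a)) (far Q a).
  by rewrite mdist_far // (metric_sym (pos Q v) (pos Q (src Q a))); lra.
have wa : mdist w (far Q a) <= len Q a.1 + E - s + c.
  have := X4 w (pos Q v) (far Q a) (far Q b).
  rewrite (metric_sym w (pos Q v)) vw wb; case; lra.
have [|Q' [Q'c Q'l Q'e]] := @fold_graph _ _ _ _ _ actI _ Q a b v w conn.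
  by move=> P inv; rewrite (abc P inv).
pose y (d : dart k) := if (d == a) || (d == b) then w else pos Q (src Q d).
exists Q'; split=> //; rewrite {}Q'e -/(y _).
under eq_bigr => e _ do rewrite -/(y (e, false)) -/(y (e, true)).
(* Bound for the change of length per folded dart; s + 2 r is the total change. *)
pose r := 3 * E + 3 * c - s.
have ysym d : mdist (y (d.1, false))
     (act (edge_label (tnth (lab Q)) d.1) (y (d.1, true))) =
   mdist (y d) (act (holonomy (tnth (lab Q)) d) (y (opp_dart d))).
  case: d => e [] //=; rewrite /holonomy /opp_dart /=.
  rewrite -[RHS](iso (edge_label (tnth (lab Q)) e)) -actM mulgV act1.
  by rewrite metric_sym.
have ledge e : mdist (y (e, false))
     (act (edge_label (tnth (lab Q)) e) (y (e, true))) <=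
   len Q e + ((a.1 == e)%:R + (b.1 == e)%:R) * r.
  have other d : d.1 = e -> y d = w -> y (opp_dart d) = pos Q (src Q (opp_dart d)) ->
      mdist (y (e, false)) (act (edge_label (tnth (lab Q)) e) (y (e, true))) =
      mdist w (far Q d).
    by move=> <-; rewrite ysym => -> ->.
  have ya : y a = w by rewrite /y eqxx.
  have yb : y b = w by rewrite /y eqxx orbT.
  have oppE d d' : d.1 = d'.1 -> d != d' -> d' = opp_dart d.
    case: d d' => [f b1] [f' b2] /= -> ; rewrite /opp_dart /=.
    by case: b1; case: b2; rewrite ?eqxx.
  have opp1 d d' : d.1 != d'.1 -> (opp_dart d == d') = false.
    by move=> dd; apply/eqP => e1; rewrite -e1 eqxx in dd.
  have oppn d : (opp_dart d == d) = false.
    by apply/eqP; case: d => f [].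
  case: (eqVneq a.1 e) => [ae|ae]; case: (eqVneq b.1 e) => [be|be].
  (* Here a and b are the two directions of one edge, which is shortened at both ends; the bound 2 s
     <= len leaves room for this. *)
  - have bo : b = opp_dart a by apply: oppE; rewrite // ae be.
    rewrite -ae ysym -bo ya yb.
    set h := holonomy _ _.
    have fa : far Q a = act h (pos Q v) by rewrite /far -bo.
    have fb : act h (far Q b) = pos Q (src Q a).
      by rewrite /far bo holonomy_opp opp_dartK -actM mulgV act1.
    have hv : mdist (pos Q v) (act h w) <= len Q b.1 - s + E.
      have := metric_triangle (pos Q v) (pos Q (src Q a)) (act h w).
      rewrite -{2}fb iso (metric_sym (far Q b)) wb.
      by rewrite (metric_sym (pos Q v) (pos Q (src Q a))); lra.
    have va' : len Q a.1 - E <= mdist (pos Q v) (far Q a).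
      have := metric_triangle (pos Q (src Q a)) (pos Q v) (far Q a).
      by rewrite mdist_far //; lra.
    have := X4 w (pos Q v) (act h w) (act h (pos Q v)).
    rewrite iso (metric_sym w (pos Q v)) vw -fa.
    have lab_eq : len Q b.1 = len Q a.1 by rewrite be ae.
    by rewrite lab_eq in hv; rewrite /r !mulr1n; case; lra.
  - rewrite (other a) //; first by rewrite /r -ae mulr1n mulr0n; lra.
    by rewrite /y oppn opp1 // ae eq_sym.
  - rewrite (other b) //; first by rewrite wb /r -be mulr1n mulr0n; lra.
    by rewrite /y oppn opp1 // be eq_sym.
  - rewrite addr0 mul0r addr0.
    have yn f : y (e, f) = pos Q (src Q (e, f)).
      rewrite /y; case: eqP => [e1|_]; first by rewrite -e1 eqxx in ae.
      by case: eqP => [e1|_] //; rewrite -e1 eqxx in be.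
    by rewrite !yn.
have sum1 (d : dart k) : \sum_e (d.1 == e)%:R = 1 :> R.
  rewrite (bigD1 d.1) //= eqxx big1 ?addr0 // => e.
  by rewrite eq_sym => /negbTE ->.
rewrite vw; apply: le_trans (_ : s + (cost Q + 2 * r) <= _); last first.
  by rewrite /r; lra.
rewrite lerD2l; apply: le_trans (ler_sum _ (fun e _ => ledge e)) _.
by rewrite big_split /= -mulr_suml big_split /= !sum1; rewrite /cost; lra.
Qed.

Definition short_adjacent k (Q : marked_graph k) (S : R) : rel 'I_k.+1 :=
  fun u w => [exists t, exists b, [&& len Q (inl t) <= S,
    src Q (inl t, b) == u & src Q (inl t, ~~ b) == w]].

Definition short_cluster k (Q : marked_graph k) (S : R) := connect (short_adjacent Q S).

Lemma short_adjacentP k (Q : marked_graph k) S u w :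
  reflect (exists t b, [/\ len Q (inl t) <= S, src Q (inl t, b) = u
                         & src Q (inl t, ~~ b) = w]) (short_adjacent Q S u w).
Proof.
apply: (iffP existsP) => [[t /existsP [b /and3P[? /eqP ? /eqP ?]]]|[t [b [h1 h2 h3]]]].
  by exists t, b.
by exists t; apply/existsP; exists b; rewrite h1 h2 h3 !eqxx.
Qed.

Lemma short_adjacent_sym k (Q : marked_graph k) S : symmetric (short_adjacent Q S).
Proof.
have h u w : short_adjacent Q S u w -> short_adjacent Q S w u.
  move=> /short_adjacentP [t [b [h1 h2 h3]]]; apply/short_adjacentP.
  by exists t, (~~ b); rewrite negbK.
by move=> u w; apply/idP/idP; exact: h.
Qed.

Lemma short_cluster_sym k (Q : marked_graph k) S : symmetric (short_cluster Q S).
Proof. exact: sym_connect_sym (@short_adjacent_sym _ _ _). Qed.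

Lemma short_cluster_invariant k (Q : marked_graph k) S (P : 'I_k.+1 -> bool) u w :
  (forall t, len Q (inl t) <= S ->
     P (src Q (inl t, false)) = P (src Q (inl t, true))) ->
  short_cluster Q S u w -> P u = P w.
Proof.
move=> inv /connectP [p pp ->]; elim: p u pp => //= u' p IH u /andP[uu' /IH <-].
have /short_adjacentP [t [b [h1 <- <-]]] := uu'.
by case: b => /=; rewrite inv.
Qed.

(** A path without repeated vertices has at most k edges. *)
Lemma short_cluster_dist k (Q : marked_graph k) S u w : 0 <= S ->
  short_cluster Q S u w -> mdist (pos Q u) (pos Q w) <= k%:R * S.
Proof.
have [act1 actM iso] := actI.
move=> S0 /connectP [p0 pp0 ->].
case: (shortenP pp0) => p pp up _.
apply: le_trans (_ : (size p)%:R * S <= _).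
  elim: p u pp {up pp0} => [|u' p IH] u /=; first by rewrite mdistxx mul0r.
  move=> /andP[/short_adjacentP [t [b [h1 h2 h3]]] /IH h].
  apply: le_trans (metric_triangle _ (pos Q u') _) _.
  rewrite -natr1 mulrDl mul1r addrC lerD // -h2 -h3.
  rewrite -(mdist_far actI Q (inl t, b)) in h1; apply: le_trans h1.
  by rewrite /far /opp_dart /holonomy /= invg1 if_same act1.
rewrite ler_wpM2r // ler_nat -ltnS.
by have := max_card (mem (u :: p)); rewrite (card_uniqP up) card_ord.
Qed.

(* The indicator of a cluster is, up to a constant, the sum mod 2 of the cuts
   defined by the tree edges that leave the cluster. *)
Lemma long_bridge k (Q : marked_graph k) S p q : tree_connected Q ->
  (forall t, S < len Q (inl t) -> exists P, separates Q t P) ->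
  ~~ short_cluster Q S p q ->
  exists t P, [/\ S < len Q (inl t), separates Q t P & P p <> P q].
Proof.
move=> conn bridge pq; apply: contrapT => noP.
have /choice [P hP] t : exists P, S < len Q (inl t) -> separates Q t P.
  have [/bridge [P ?]|_] := boolP (S < len Q (inl t)); first by exists P.
  by exists (fun=> true).
have Ppq t : S < len Q (inl t) -> P t p = P t q.
  by move=> St; apply: contrapT => ne; case: noP; exists t, (P t); split=> //; exact: hP.
pose leaves t := short_cluster Q S p (src Q (inl t, false)) !=
                 short_cluster Q S p (src Q (inl t, true)).
have leavesS t : leaves t -> S < len Q (inl t).
  rewrite ltNge; apply: contraNN => tS; apply/eqP.
  apply: (@same_connect_r _ _ (@short_cluster_sym _ Q S)).
  by apply: connect1; apply/short_adjacentP; exists t, false.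
(* Along a tree edge s, the cluster indicator changes exactly when [leaves s], and among the cuts in
   the sum only [P s] changes. So F is constant, while these cuts do not distinguish p from q. *)
pose F u := short_cluster Q S p u (+) \big[addb/false]_(t | leaves t) P t u.
have Finv s : F (src Q (inl s, false)) = F (src Q (inl s, true)).
  set x := src Q (inl s, false); set y := src Q (inl s, true).
  have xorF b1 b2 : b1 (+) b2 = false -> b1 = b2 by case: b1; case: b2.
  have xorT b1 b2 : b1 != b2 -> b1 (+) b2 = true by case: b1; case: b2.
  have other t : t != s -> leaves t -> P t x (+) P t y = false.
    move=> ts /leavesS /hP [_ /(_ s)]; rewrite eq_sym => /(_ ts) ->.
    by rewrite addbb.
  apply: xorF; rewrite /F addbACA -big_split /=.
  have [ls|ls] := boolP (leaves s).
    rewrite (bigD1 s) //= big1 => [|t /andP[lt ts]]; last exact: other.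
    have [/eqP ne _] := hP _ (leavesS _ ls).
    by rewrite (xorT _ _ ls) (xorT _ _ ne).
  rewrite big1 => [|t lt]; last by apply: other => //; apply: contraNneq ls => <-.
  by move: ls; rewrite /leaves negbK => /eqP ->; rewrite addbb.
have := conn F Finv p q; rewrite /F (negbTE pq) /short_cluster connect0 /=.
rewrite (eq_bigr (fun t => P t q)); first by case: (\big[_/_]_(_ | _) _).
by move=> t /leavesS; exact: Ppq.
Qed.

End Scales.

(** * Near-minimal graphs *)

(** Pigeonhole: m disjoint intervals cannot all contain one of fewer than m values. *)
Lemma scale_gap {R : realType} (T : finType) (f : T -> R) (K : nat -> R) m :
  (#|T| < m)%N -> {homo K : i j / (i <= j)%N >-> i <= j} ->
  exists2 j, (j < m)%N & forall e, f e <= K j \/ K j.+1 < f e.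
Proof.
move=> Tm Kmono; apply: contrapT => nogap.
have /choice [g hg] (j : 'I_m) : exists e, K j < f e <= K j.+1.
  apply: contrapT => /forallNP noe; case: nogap; exists j => // e.
  case: (leP (f e) (K j)) => h1; first by left.
  case: (leP (f e) (K j.+1)) => h2; last by right.
  by case: (noe e); rewrite h1.
have ginj : injective g.
  have lt (i j : 'I_m) : (i < j)%N -> g i <> g j.
    move=> ij gij; have /andP[_ h1] := hg i; have /andP[h2 _] := hg j.
    have := le_lt_trans (Kmono _ _ ij) h2.
    by rewrite -gij => /lt_le_trans /(_ h1); rewrite ltxx.
  move=> i j gij; apply/val_inj; case: (ltngtP (val i) (val j)) => // ij.
    by have := lt _ _ ij.
  by have := lt _ _ ij; rewrite gij.
by have := leq_card g ginj; rewrite card_ord leqNgt Tm.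
Qed.

Section NearMinimal.
Context {R : realType} {G : groupType} {X : metricType R} {n : nat}.
Variables (act : G -> X -> X) (c : R).
Hypotheses (actI : isometric_action act) (Xgeo : geodesic_space X)
  (X4 : @four_point R X c).
Variables (M : n.-tuple G) (delta I : R).

Local Notation marked_graph := (@marked_graph R G X n).
Local Notation len := (len act).
Local Notation cost := (cost act).
Local Notation far := (far act).
Local Notation short_cluster := (short_cluster act).

Hypothesis cost_inf : forall k (Q : marked_graph k), tree_connected Q ->
  nielsen_equivalent M (lab Q) -> I <= cost Q.

Definition near_minimal k (Q : marked_graph k) : Prop :=
  [/\ tree_connected Q, nielsen_equivalent M (lab Q) & cost Q < I + delta].

Lemma near_minimal_bounded k (Q : marked_graph k) : near_minimal Q ->
  exists k', (k' <= n * 2)%N /\ exists Q' : marked_graph k', near_minimal Q'.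
Proof.
elim: k Q => [|k IH] Q nQ; first by exists 0; split=> //; exists Q.
have [kn|kn] := leqP k.+1 (n * 2); first by exists k.+1; split=> //; exists Q.
have [v deg2] := @exists_low_degree _ _ _ _ _ Q (ltn_addr 3 kn).
have [conn QM Qd] := nQ.
have [Q' [conn' lab' cost']] := contract_vertex actI conn deg2.
apply: (IH Q'); split=> //; first by rewrite lab'.
exact: le_lt_trans Qd.
Qed.

Lemma near_minimal_bridge k (Q : marked_graph k) t : near_minimal Q ->
  delta <= len Q (inl t) -> exists P, separates Q t P.
Proof.
move=> [conn QM Qd] dt.
have [//|[Q' [conn' lab' cost']]] := bridge_or_shorten actI t conn.
by have := cost_inf conn'; rewrite lab' cost' => /(_ QM); lra.
Qed.

(** Each short loop edge is exchanged with a long tree edge, so the number of short loop edges,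
    bounded by [r], drops. Lengths are only permuted, which preserves the gap and the cost. *)
Lemma near_minimal_long_loops k (Q : marked_graph k) S L :
  near_minimal Q -> 0 <= S -> delta <= L ->
  (forall e, len Q e <= S \/ L < len Q e) -> S < L ->
  (forall N i y, nielsen_equivalent M N ->
     (k%:R + 1) * S < mdist (act (tnth N i) y) y) ->
  exists Q' : marked_graph k, [/\ near_minimal Q',
    forall e, len Q' e <= S \/ L < len Q' e & forall i, L < len Q' (inr i)].
Proof.
move=> nQ S0 dL gap SL disp.
have [r le_r] := ubnP #|[set i | len Q (inr i) <= S]|.
elim: r Q nQ gap le_r => // r IH Q nQ gap le_r.
have [|noi] := pselect (exists i, len Q (inr i) <= S); last first.
  exists Q; split=> // i; case: (gap (inr i)) => // iS.
  by case: noi; exists i.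
move=> [i iS].
have [conn QM Qd] := nQ.
have bridge t : S < len Q (inl t) -> exists P, separates Q t P.
  move=> St; apply: near_minimal_bridge => //.
  by case: (gap (inl t)) => h; lra.
(* With both ends in one cluster, the label of i would move a point by at most k S + S. *)
have ncl : ~~ short_cluster Q S (src Q (inr i, false)) (src Q (inr i, true)).
  apply/negP => /(short_cluster_dist actI S0) d1.
  have := disp (lab Q) i (pos Q (src Q (inr i, true))) QM.
  have := metric_triangle (act (tnth (lab Q) i) (pos Q (src Q (inr i, true))))
    (pos Q (src Q (inr i, false))) (pos Q (src Q (inr i, true))).
  rewrite (metric_sym (act _ _) (pos Q (src Q (inr i, false)))).
  by move: iS; rewrite /len /far /holonomy /=; lra.
have [t [P [St sepP Pi]]] := long_bridge conn bridge ncl.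
have [Q' [conn' QQ' lenQ']] := exchange_edges actI conn sepP Pi.
apply: (IH Q').
- split=> //; first exact: nielsen_equivalent_trans QQ'.
  suff -> : cost Q' = cost Q by [].
  rewrite /cost [RHS](reindex_inj (@perm_inj _ (tperm (inl t) (inr i)))) /=.
  by apply: eq_bigr => e _; exact: lenQ'.
- by move=> e; rewrite lenQ'.
- rewrite -ltnS; apply: leq_ltn_trans le_r.
  apply: proper_card; apply/properP; split; last first.
    by exists i; rewrite inE // lenQ' tpermR -ltNge.
  apply/fintype.subsetP => j; rewrite !inE lenQ'.
  by case: tpermP => [//|[->] _|_ _ //]; exact: iS.
Qed.

(** With this s, folding would save s - 6 E - 6 c = delta and bring the cost below the lower bound
    I. *)
Lemma near_minimal_fold k (Q : marked_graph k) S L a b :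
  let E := k%:R * S in let s := 6 * E + 6 * c + delta in
  near_minimal Q -> 0 <= S -> 0 <= delta -> S < L -> 2 * s <= L ->
  a != b -> L < len Q a.1 -> L < len Q b.1 -> short_cluster Q S (src Q a) (src Q b) ->
  mdist (pos Q (src Q b)) (far Q a) + mdist (pos Q (src Q b)) (far Q b)
    - mdist (far Q a) (far Q b) < 2 * s.
Proof.
move=> E s nQ S0 d0 SL sL ab La Lb cab.
have [conn QM Qd] := nQ.
rewrite ltNge; apply/negP => overlap.
have c0 : 0 <= c.
  have p := pos Q (src Q a).
  by have := X4 p p p p; rewrite mdistxx; lra.
have E0 : 0 <= E by rewrite mulr_ge0.
have [|||||Q' [conn' lab' cost']] := fold_cost (E := E) (s := s) actI Xgeo X4 conn ab _ _ _ _ _ overlap.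
- move=> P inv; apply: short_cluster_invariant cab => t tS.
  apply: inv; first by apply: contraTneq La => <-; rewrite -leNgt; lra.
  by apply: contraTneq Lb => <-; rewrite -leNgt; lra.
- exact: short_cluster_dist cab.
- by rewrite /s; lra.
- lra.
- lra.
have := cost_inf conn'; rewrite lab' => /(_ QM).
by move: cost'; rewrite /s; lra.
Qed.

End NearMinimal.

(** * Long paths *)

Section LongPaths.
Context {R : realType} {G : groupType} {X : metricType R} {n : nat}.
Variables (act : G -> X -> X) (c : R).
Hypotheses (actI : isometric_action act) (X4 : @four_point R X c).

Local Notation dart k := (('I_k + 'I_n) * bool)%type.
Local Notation len := (len act).
Local Notation far := (far act).
Local Notation short_cluster := (short_cluster act).

Variables (k : nat) (Q : @marked_graph R G X n k) (S L : R).

(* A path in the graph obtained by collapsing the short tree edges, given by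
   its sequence of long darts. *)
Fixpoint long_path u (ds : seq (dart k)) w : bool :=
  if ds is d :: ds' then
    [&& short_cluster Q S u (src Q d), L < len Q d.1
      & long_path (src Q (opp_dart d)) ds' w]
  else short_cluster Q S u w.

Definition reduced (ds : seq (dart k)) := sorted (fun d d' => d' != opp_dart d) ds.

Definition path_holonomy {H : groupType} (h : 'I_n -> H) (ds : seq (dart k)) : H :=
  (\prod_(d <- ds) holonomy h d)%g.

Lemma path_holonomy_cons {H : groupType} (h : 'I_n -> H) d ds :
  path_holonomy h (d :: ds) = (holonomy h d * path_holonomy h ds)%g.
Proof. by rewrite /path_holonomy big_cons. Qed.

Lemma path_holonomy_nil {H : groupType} (h : 'I_n -> H) :
  path_holonomy h [::] = 1%g.
Proof. by rewrite /path_holonomy big_nil. Qed.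

Lemma path_holonomy_cat {H : groupType} (h : 'I_n -> H) ds ds' :
  path_holonomy h (ds ++ ds') = (path_holonomy h ds * path_holonomy h ds')%g.
Proof. by rewrite /path_holonomy big_cat. Qed.

Lemma long_path_trans u v ds w :
  short_cluster Q S u v -> long_path v ds w -> long_path u ds w.
Proof.
case: ds => [|d ds] /= uv; first exact: connect_trans uv.
by case/and3P => vd -> ->; rewrite !andbT; exact: (connect_trans uv vd).
Qed.

Lemma long_path_cat u ds v ds' w :
  long_path u ds v -> long_path v ds' w -> long_path u (ds ++ ds') w.
Proof.
elim: ds u => [|d ds IH] u /=; first exact: long_path_trans.
by case/and3P => -> -> /IH.
Qed.

(** Backtracking is cancelled. Holonomies are compared in all groups at once, as if in the free
    group on the labels, so that an empty reduced path makes the word trivial in every group. *)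
Lemma reduce_long_path u ds w : long_path u ds w ->
  exists ds', [/\ long_path u ds' w, reduced ds'
    & forall (H : groupType) (h : 'I_n -> H),
        path_holonomy h ds' = path_holonomy h ds].
Proof.
elim: ds u => [|d ds IH] u /=; first by exists [::].
move=> /and3P[ud dL /IH [ds' [p' r' hol]]].
case: ds' p' r' hol => [|d' ds'] p' r' hol.
  exists [:: d]; split=> //=; first by rewrite ud dL.
  by move=> H h; rewrite !path_holonomy_cons hol.
have [dd'|dd'] := eqVneq d' (opp_dart d); last first.
  exists [:: d, d' & ds']; split.
  - by rewrite [long_path _ _ _]/= ud dL.
  - by rewrite /reduced /= dd'.
  - by move=> H h; rewrite path_holonomy_cons hol -path_holonomy_cons.
exists ds'; split.
- move: p'; rewrite dd' /= opp_dartK => /and3P[_ _].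
  exact: long_path_trans.
- by move: r'; rewrite /reduced /=; exact: path_sorted.
- move=> H h; rewrite [RHS]path_holonomy_cons -hol path_holonomy_cons dd'.
  by rewrite holonomy_opp mulVKg.
Qed.

Hypothesis conn : tree_connected Q.
Hypothesis gap : forall e, len Q e <= S \/ L < len Q e.

(** Connectedness is applied to the set of vertices reachable from u by such paths. *)
Lemma tree_long_path u w : exists2 ds, long_path u ds w &
  forall (H : groupType) (h : 'I_n -> H), path_holonomy h ds = 1%g.
Proof.
pose P v := `[< exists2 ds, long_path u ds v &
  forall (H : groupType) (h : 'I_n -> H), path_holonomy h ds = 1%g >].
have step t b : P (src Q (inl t, b)) -> P (src Q (inl t, ~~ b)).
  move=> /asboolP [ds p hol]; apply/asboolP.
  have [tS|tL] := gap (inl t).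
    exists ds => //; rewrite -[ds]cats0; apply: long_path_cat p _ => /=.
    by apply: connect1; apply/short_adjacentP; exists t, b.
  exists (ds ++ [:: (inl t, b)]).
    by apply: long_path_cat p _; rewrite /= tL /short_cluster !connect0.
  move=> H h; rewrite path_holonomy_cat hol mul1g path_holonomy_cons.
  by rewrite path_holonomy_nil /holonomy /= invg1 if_same mulg1.
apply/asboolP; rewrite -/(P w) (conn (P := P) _ w u).
  apply/asboolP; exists [::]; first exact: connect0.
  by move=> H h; exact: path_holonomy_nil.
by move=> t; apply/idP/idP => /step.
Qed.

Hypothesis loops : forall i, L < len Q (inr i).

(** For each letter, go through the tree to the source of its edge, cross the edge, and return to o
    through the tree. *)
Lemma word_long_path o (w : seq ('I_n * bool)) : exists2 ds, long_path o ds o &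
  forall (H : groupType) (h : 'I_n -> H), path_holonomy h ds = eval_word h w.
Proof.
elim: w => [|[i b] w [ds p hol]].
  exists [::]; first exact: connect0.
  by move=> H h; rewrite path_holonomy_nil /eval_word big_nil.
have [ds1 p1 hol1] := tree_long_path o (src Q (inr i, b)).
have [ds2 p2 hol2] := tree_long_path (src Q (opp_dart (inr i, b))) o.
exists (ds1 ++ (inr i, b) :: (ds2 ++ ds)).
  apply: long_path_cat p1 _; rewrite /= loops {1}/short_cluster connect0 /=.
  exact: long_path_cat p2 p.
move=> H h; rewrite path_holonomy_cat hol1 mul1g path_holonomy_cons.
rewrite path_holonomy_cat hol2 mul1g hol eval_word_cons /holonomy /=.
by case: b {p1 p2}.
Qed.

Lemma path_word (ds : seq (dart k)) : exists2 w : seq ('I_n * bool),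
  (size w <= size ds)%N &
  forall (H : groupType) (h : 'I_n -> H), eval_word h w = path_holonomy h ds.
Proof.
elim: ds => [|[[t|i] b] ds [w ws hol]].
- exists [::] => // H h; rewrite path_holonomy_nil /eval_word big_nil //.
- exists w; first exact: leqW.
  move=> H h; rewrite path_holonomy_cons /holonomy /= invg1 if_same mul1g.
  exact: hol.
- exists ((i, b) :: w) => // H h.
  by rewrite path_holonomy_cons eval_word_cons hol /holonomy; case: b.
Qed.

Variables (E s delta : R).
Hypothesis cluster_E : forall u w, short_cluster Q S u w ->
  mdist (pos Q u) (pos Q w) <= E.
Hypothesis no_fold : forall a b, a != b -> L < len Q a.1 -> L < len Q b.1 ->
  short_cluster Q S (src Q a) (src Q b) ->
  mdist (pos Q (src Q b)) (far Q a) + mdist (pos Q (src Q b)) (far Q b)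
    - mdist (far Q a) (far Q b) < 2 * s.
Hypotheses (delta_gt0 : 0 < delta) (s_ge0 : 0 <= s)
  (L_large : 2 * E + 4 * s + 2 * c + delta <= L).

(* Local-to-global: by induction from the end of the path, the end point lies
   in the direction of the first dart. *)
Lemma reduced_path_far d ds z : L < len Q d.1 ->
  long_path (src Q (opp_dart d)) ds z -> reduced (d :: ds) ->
  let p := pos Q (src Q d) in
  let y := act (path_holonomy (tnth (lab Q)) (d :: ds)) (pos Q z) in
  2 * len Q d.1 - (2 * E + 2 * s + c) <= len Q d.1 + mdist p y - mdist (far Q d) y
  /\ (size ds)%:R * delta + L - E <= mdist p y.
Proof.
have [act1 actM iso] := actI.
have d0 := delta_gt0; have s0 := s_ge0; have LL := L_large.
have E0 : 0 <= E by have := cluster_E (connect0 _ z); rewrite mdistxx.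
have c0 : 0 <= c.
  by have := X4 (pos Q z) (pos Q z) (pos Q z) (pos Q z); rewrite mdistxx; lra.
elim: ds d => [|d' ds IH] d dL /= pth red; set p := pos Q (src Q d).
  rewrite path_holonomy_cons path_holonomy_nil mulg1.
  set y := act _ _; have fy : mdist (far Q d) y <= E.
    by rewrite /far /y iso; exact: cluster_E.
  have pf : mdist p (far Q d) = len Q d.1 by exact: mdist_far.
  have := metric_triangle p y (far Q d); rewrite (metric_sym y) pf mul0r.
  lra.
case/and3P: pth => qd' d'L pth.
have /andP[dd' red'] : (d' != opp_dart d) && reduced (d' :: ds) by [].
have [] := IH d' d'L pth red'.
set q := src Q (opp_dart d); set p' := pos Q (src Q d').
rewrite [in X in _ -> _ -> X]path_holonomy_cons actM.
set y' := act (path_holonomy _ (d' :: ds)) (pos Q z).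
set g := holonomy _ d => IH1 IH2.
have fq : far Q d = act g (pos Q q) by [].
have dq : far Q (opp_dart d) = act g^-1%g p by rewrite /far holonomy_opp opp_dartK.
(* After translation by g^-1 the path continues from the base lift of d', and B is the point where
   it started. *)
set B := far Q (opp_dart d) in dq *.
have gB : act g B = p by rewrite dq -actM mulgV act1.
have e1 : mdist p (act g y') = mdist B y' by rewrite -gB iso.
have e2 : mdist (far Q d) (act g y') = mdist (pos Q q) y' by rewrite fq iso.
have qp' : mdist (pos Q q) p' <= E by exact: cluster_E.
have qB : mdist (pos Q q) B = len Q d.1 by exact: mdist_far.
have pd' : mdist p' (far Q d') = len Q d'.1 by exact: mdist_far.
have nf : mdist p' B + mdist p' (far Q d') - mdist B (far Q d') < 2 * s.
  by apply: no_fold; rewrite // eq_sym.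
have t1 := metric_triangle (pos Q q) p' B.
have t2 := metric_triangle (pos Q q) p' y'.
(* At p', the points y' and [far Q d'] have a large Gromov product by induction, while B and
   [far Q d'] have one below s. So the product of B and y' is at most s + c / 2; the size of L
   excludes the other alternative of the four-point condition. *)
have star : mdist p' B + mdist p' y' - 2 * s - c <= mdist B y'.
  have := X4 B y' (far Q d') p'.
  rewrite (metric_sym (far Q d') p') (metric_sym B p') (metric_sym y' p').
  rewrite (metric_sym y' (far Q d')) pd' in IH1 nf *.
  by case; lra.
rewrite e1 e2 -natr1 mulrDl mul1r; split; lra.
Qed.

(** Moving the base point within the first cluster costs E, which the surplus L of a nonempty path
    absorbs. *)
Lemma reduced_loop_length o ds : long_path o ds o -> reduced ds ->
  (size ds)%:R * delta <=
    mdist (pos Q o) (act (path_holonomy (tnth (lab Q)) ds) (pos Q o)).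
Proof.
have d0 := delta_gt0; have s0 := s_ge0; have LL := L_large.
have E0 : 0 <= E by have := cluster_E (connect0 _ o); rewrite mdistxx.
have c0 : 0 <= c.
  by have := X4 (pos Q o) (pos Q o) (pos Q o) (pos Q o); rewrite mdistxx; lra.
case: ds => [_ _|d ds /= /and3P[/cluster_E od dL pth] red].
  by rewrite mul0r mdist_ge0.
have [_ h] := reduced_path_far dL pth red.
set y := act _ _ in h *.
have := metric_triangle (pos Q (src Q d)) (pos Q o) y.
rewrite (metric_sym _ (pos Q o)) -natr1 mulrDl mul1r; lra.
Qed.

End LongPaths.

(** * Choice of scales and conclusion *)

Theorem theorem1 (R : realType) (n : nat) (hn : (0 < n)%N) :
  exists C : R,
    forall (G : groupType) (X : metricType R) (x0 : X) (delta : R)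
           (act : G -> X -> X) (M : n.-tuple G),
      0 < delta -> geodesic_space X -> @hyperbolic R X delta ->
      isometric_action act -> generates M ->
      (free_on M /\
       forall x : X,
         quasi_isometric_embedding (word_metric R M) (@mdist R X)
           (fun h : G => act h x))
      \/
      (exists M' : n.-tuple G,
         nielsen_equivalent M M' /\
         exists y : X, mdist (act (tnth M' (Ordinal hn)) y) y < delta * C).
Proof.
(* More than the number of edges, at most 2 n in the tree and n outside it. *)
pose m := (n * 2 + n).+1.
(* Scales in units of [delta]. The factor 2 n + 1 >= k + 1 accounts for the diameter of a cluster;
   100 and 1000 are generous, as about 26 E + 161 delta <= L is needed. *)
pose K (j : nat) : R := iter j (fun a => 100 * (n * 2).+1%:R * a + 1000) 0.
exists (K m + 1) => G X x0 delta act M d0 Xgeo Xhyp actI gM.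
have [act1 actM iso] := actI.
have X4 := hyperbolic_four_point d0 Xgeo Xhyp; set c := 6 * delta in X4.
have [[N [i [y [MN Niy]]]]|disp] := pselect (exists N i y,
    nielsen_equivalent M N /\ mdist (act (tnth N i) y) y < delta * (K m + 1)).
  right; have [ii|ii] := eqVneq i (Ordinal hn).
    by exists N; split=> //; exists y; rewrite -ii.
  exists [tuple tnth N (tperm i (Ordinal hn) j) | j < n]; split.
    apply: nielsen_equivalent_trans MN _.
    by apply: rt_step; exact: nielsen_swap.
  by exists y; rewrite tnth_mktuple tpermR.
left.
have disp' N i y : nielsen_equivalent M N ->
    delta * (K m + 1) <= mdist (act (tnth N i) y) y.
  move=> MN; rewrite leNgt; apply/negP => h; apply: disp.
  by exists N, i, y.
have K0 j : 0 <= K j.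
  by elim: j => //= j IH; rewrite addr_ge0 // !mulr_ge0.
have KS j : 100 * K j + 1000 <= K j.+1.
  have h := K0 j; rewrite /K /= -/(K j) -[(n * 2).+1%:R]natr1 mulrDr mulr1 mulrDl.
  have : 0 <= 100 * (n * 2)%:R * K j by rewrite !mulr_ge0.
  lra.
have Kmono : {homo K : i j / (i <= j)%N >-> i <= j}.
  apply: homo_leq => //; first exact: le_trans.
  by move=> j; have := KS j; have := K0 j; lra.
pose costs : set R := [set r | exists k (Q : @marked_graph R G X n k),
  [/\ tree_connected Q, nielsen_equivalent M (lab Q) & cost act Q = r]]%classic.
pose I := inf costs.
have lb : lbound costs 0 by move=> _ [k [Q [_ _ <-]]]; exact: cost_ge0.
have ne : (costs !=set0)%classic.
  (* The rose with its single vertex at x0. *)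
  pose Q0 := @MarkedGraph R G X n 0 (fun=> ord0) (fun=> x0) M.
  exists (cost act Q0), 0, Q0; split=> //.
  - by move=> P _ u v; rewrite (ord1 u) (ord1 v).
  - exact: nielsen_equivalent_refl.
have cost_inf k (Q : @marked_graph R G X n k) : tree_connected Q ->
    nielsen_equivalent M (lab Q) -> I <= cost act Q.
  by move=> *; apply: ge_inf; [exists 0|exists k, Q].
have [_ [k0 [Q0 [Q0c Q0M <-]]] Q0I] := inf_adherent d0 (conj ne (ex_intro _ 0 lb)).
have [k [kn [Q1 Q1near]]] := @near_minimal_bounded _ _ _ _ _ actI M delta I _ Q0
  (And3 Q0c Q0M Q0I).
have [||j jm gap1] := @scale_gap R _ (fun e => len act Q1 e) (fun j => delta * K j) m.
- by rewrite card_sum !card_ord ltnS leq_add2r.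
- by move=> i j ij; rewrite ler_pM2l // Kmono.
set S := delta * K j in gap1; set L := delta * K j.+1 in gap1.
have S0 : 0 <= S by rewrite mulr_ge0 // ltW.
have kn' : k%:R + 1 <= (n * 2).+1%:R :> R by rewrite natr1 ler_nat.
have LE : 100 * (k%:R + 1) * S + 1000 * delta <= L.
  have -> : L = 100 * ((n * 2).+1%:R * S) + 1000 * delta.
    by rewrite /L /S /K /=; ring.
  by rewrite lerD2r -mulrA ler_pM2l // ler_wpM2r.
have LKm : L <= delta * K m by rewrite ler_pM2l // Kmono.
set E := k%:R * S.
have E0 : 0 <= E by rewrite mulr_ge0.
have LE' : 100 * E + 100 * S + 1000 * delta <= L.
  by move: LE; rewrite mulrDr mulr1 mulrDl -mulrA -/E.
pose s := 6 * E + 6 * c + delta.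
have [|||Q [Qnear gap loops]] := near_minimal_long_loops actI cost_inf Q1near S0 _ gap1.
- lra.
- lra.
- move=> N i y MN; apply: lt_le_trans (disp' N i y MN).
  rewrite mulrDl mul1r -/E mulrDr mulr1; lra.
have [Qc QM _] := Qnear.
have no_fold a b : a != b -> L < len act Q a.1 -> L < len act Q b.1 ->
    short_cluster act Q S (src Q a) (src Q b) ->
    mdist (pos Q (src Q b)) (far act Q a) + mdist (pos Q (src Q b)) (far act Q b)
      - mdist (far act Q a) (far act Q b) < 2 * s.
  by apply: (near_minimal_fold actI Xgeo X4 cost_inf Qnear S0 (ltW d0)); rewrite -/E /c; lra.
pose o : 'I_k.+1 := ord0.
have loop_length ds := @reduced_loop_length _ _ _ _ _ c actI X4 _ Q S L E s delta
  (fun u w => @short_cluster_dist _ _ _ _ _ actI _ Q S u w S0) no_fold d0 _ _ o ds.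
have gN := nielsen_equivalent_generates QM gM.
have loop w : exists ds : seq (('I_k + 'I_n) * bool),
    (size ds)%:R * delta <= mdist (pos Q o) (act (word_value (lab Q) w) (pos Q o)) /\
    forall (H : groupType) (h : 'I_n -> H), path_holonomy h ds = eval_word h w.
  have [ds0 p0 hol0] := word_long_path Qc gap loops o w.
  have [ds [p red hol]] := reduce_long_path p0.
  exists ds; split; last by move=> H h; rewrite hol hol0.
  rewrite word_valueE -hol0 -hol; apply: loop_length => //; rewrite /s /c; lra.
split.
  apply: (nielsen_equivalent_free QM); apply: free_on_words => // H h w w1.
  have [ds [sz hol]] := loop w; move: sz.
  (* A word trivial in G has displacement zero, so its reduced path is empty. *)
  rewrite w1 act1 mdistxx pmulr_lle0 // lern0 => /eqP/size0nil ds0.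
  by rewrite -hol ds0 path_holonomy_nil.
apply: (quasi_isometric_embedding_words actI gM (x0 := pos Q o)).
apply: (nielsen_equivalent_length QM).
(* Each dart of the reduced path contributes at least [delta] to the displacement and at most one
   letter to the word. *)
exists delta^-1 => g; have [w wg] := gN g.
have [ds [sz hol]] := loop w; have [w' ws hol'] := path_word ds.
exists w'; first by rewrite word_valueE hol' hol.
apply: le_trans (_ : (size ds)%:R <= _); first by rewrite ler_nat.
rewrite ler_pdivlMl // mulrC -wg.
by apply: le_trans sz _; rewrite lerDr.
Qed.
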